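(* Let $q\in(0,1)$ and let $\gamma>0$ be real. The operator $\nabla^{(-\gamma)}_q$ is the inverse of the operator $\nabla^{(\gamma)}_q$ on $\omega$, that is, $$\nabla^{(\gamma)}_q\nabla^{(-\gamma)}_q=I=\nabla^{(-\gamma)}_q\nabla^{(\gamma)}_q,$$ where $I$ is the identity operator on $\omega$.
   Context: $\mathbb{Z}^+_0=\{0,1,2,\dots\}$, and $\omega$ is the complex vector space of all sequences $g=(g_j)_{j\in\mathbb{Z}^+_0}$ of complex numbers, with the convention $g_j=0$ for $j<0$. For real $x$, $[x]_q=\frac{1-q^x}{1-q}$; $[0]_q!=1$ and $[k]_q!=\prod_{i=1}^k[i]_q$. Empty products equal $1$. The operators $\nabla^{(\gamma)}_q,\nabla^{(-\gamma)}_q:\omega\to\omega$ are defined by $$(\nabla^{(\gamma)}_q g)_j=\sum_{k=0}^{\infty}(-1)^k q^{\binom{k}{2}}\frac{\prod_{i=0}^{k-1}[\gamma-i]_q}{[k]_q!}\,g_{j-k}=g_j-[\gamma]_q g_{j-1}+q\frac{[\gamma]_q[\gamma-1]_q}{[2]_q!}g_{j-2}-\cdots,$$ $$(\nabla^{(-\gamma)}_q g)_j=\sum_{k=0}^{\infty}\frac{\prod_{i=0}^{k-1}[\gamma+i]_q}{[k]_q!}\,g_{j-k}=g_j+[\gamma]_q g_{j-1}+\frac{[\gamma]_q[\gamma+1]_q}{[2]_q!}g_{j-2}+\cdots$$ for $j\in\mathbb{Z}^+_0$ (finite sums, since $g_{j-k}=0$ for $k>j$). Note that $\nabla^{(-\gamma)}_q$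 is a separate definition, not the first formula with $\gamma$ replaced by $-\gamma$. *)

(* Defs.v *)
From mathcomp Require Import all_boot all_order all_algebra.
From mathcomp Require Import all_classical all_reals all_analysis.
From mathcomp Require Import complex.
Set Implicit Arguments.
Unset Strict Implicit.
Unset Printing Implicit Defensive.
Import Order.TTheory GRing.Theory Num.Theory.
Local Open Scope ring_scope.
Local Open Scope complex_scope.

Definition omega (R : realType) : Type := nat -> R[i].

Definition qnum (R : realType) (q x : R) : R := (1 - q `^ x) / (1 - q).

Definition qfact (R : realType) (q : R) (k : nat) : R :=
  \prod_(1 <= i < k.+1) qnum q i%:R.

Definition nabla_coef (R : realType) (q gamma : R) (k : nat) : R :=
  (-1) ^+ k * q ^+ 'C(k, 2) *
  ((\prod_(0 <= i < k) qnum q (gamma - i%:R)) / qfact q k).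

Definition nabla_neg_coef (R : realType) (q gamma : R) (k : nat) : R :=
  (\prod_(0 <= i < k) qnum q (gamma + i%:R)) / qfact q k.

(* In both operators the series over k is truncated at k = j: the terms with
   k > j vanish by the convention g_j = 0 for j < 0, so the truncated
   subtraction (j - k)%N is only ever used for k <= j. *)
Definition nabla (R : realType) (q gamma : R) (g : omega R) : omega R :=
  fun j => \sum_(0 <= k < j.+1) (nabla_coef q gamma k)%:C * g (j - k)%N.

Definition nabla_neg (R : realType) (q gamma : R) (g : omega R) : omega R :=
  fun j => \sum_(0 <= k < j.+1) (nabla_neg_coef q gamma k)%:C * g (j - k)%N.

(* Main.v *)
Require Import Defs.
From mathcomp Require Import all_boot all_order all_algebra.
From mathcomp Require Import all_classical all_reals all_analysis.
From mathcomp Require Import complex.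
From mathcomp Require Import ring.
Set Implicit Arguments.
Unset Strict Implicit.
Unset Printing Implicit Defensive.
Import Order.TTheory GRing.Theory Num.Theory.
Local Open Scope ring_scope.

(** Both operators are convolutions with a fixed sequence of coefficients, so
    the theorem says that the two generating series are inverse to each other.
    With [t = q ^ gamma] the [q]-binomial theorem identifies them as
    [A(x) = (x; q)_oo / (t x; q)_oo] and [B(x) = (t x; q)_oo / (x; q)_oo].

    Infinite products can be avoided.  The coefficients satisfy
    [(1 - q^(k+1)) a_(k+1) = (t - q^k) a_k] and
    [(1 - q^(k+1)) b_(k+1) = (1 - t q^k) b_k] ([nabla_coefS],
    [nabla_neg_coefS]); these are the functional equations
    [(1 - t x) A(x) = (1 - x) A(q x)] and [(1 - x) B(x) = (1 - t x) B(q x)]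
    read off coefficientwise.  They give a first-order recurrence for the
    coefficients [c_n] of the product,
    [(1 - q^(n+1)) c_(n+1) = t (1 - q^n) c_n] ([conv_qrecS]).  Its right-hand
    side vanishes at [n = 0], whence [c_n = 0] for all [n > 0], while [c_0 = 1]
    ([conv_qrec]).  Associativity and commutativity of convolution turn this
    into the two identities between operators. *)

(** * Convolution of sequences *)

Section Convolution.
Variable K : comNzRingType.
Implicit Types f g h : nat -> K.

Definition conv f g : nat -> K :=
  fun n => \sum_(0 <= k < n.+1) f k * g (n - k)%N.

(** Convolution at [n] only sees the first entries of its arguments, so it is
    computed by a product of truncating polynomials; its algebraic laws are
    thereby inherited from the polynomial ring. *)
Lemma coef_trunc_mul f g N n : (n < N)%N ->
  (\poly_(i < N) f i * \poly_(i < N) g i)`_n = conv f g n.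
Proof.
move=> ltnN; rewrite coefM /conv big_mkord; apply: eq_bigr => i _.
rewrite !coef_poly (leq_ltn_trans (leq_subr _ _) ltnN).
by rewrite (leq_ltn_trans _ ltnN) // -ltnS.
Qed.

Lemma convC f g : conv f g = conv g f.
Proof.
by apply/funext => n; rewrite -!(coef_trunc_mul _ _ (ltnSn n)) mulrC.
Qed.

Lemma convA f g h : conv f (conv g h) = conv (conv f g) h.
Proof.
apply/funext => n; pose P u := \poly_(i < n.+1) (u i : K).
have Pconv u v m : (m < n.+1)%N -> (P u * P v)`_m = conv u v m.
  exact: coef_trunc_mul.
transitivity ((P f * (P g * P h))`_n).
  rewrite coefM /conv big_mkord; apply: eq_bigr => i _.
  by rewrite Pconv ?ltnS ?leq_subr // coef_poly ltn_ord.
rewrite mulrA coefM /conv big_mkord; apply: eq_bigr => i _.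
by rewrite Pconv ?ltn_ord // coef_poly ltnS leq_subr.
Qed.

Lemma conv1s g : conv (fun n => (n == 0)%:R) g = g.
Proof.
apply/funext => n; rewrite /conv big_nat_recl //= mul1r subn0 big1 ?addr0 //.
by move=> i _; rewrite mul0r.
Qed.

End Convolution.

(** * Sequences with first-order q-recurrences *)

Section QRecurrence.
Variables (K : idomainType) (q t : K) (a b : nat -> K).
Hypothesis aS : forall k, (1 - q ^+ k.+1) * a k.+1 = (t - q ^+ k) * a k.
Hypothesis bS : forall k, (1 - q ^+ k.+1) * b k.+1 = (1 - t * q ^+ k) * b k.

(** Writing [1 - q^(n+1) = (1 - q^k) + q^k (1 - q^(n+1-k))] in the [k]-th term
    lets the first part lower the index of [a] and the second that of [b].
    Both resulting sums run over the terms of [c_n], and the weights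
    [t - q^k] and [q^k - t q^n] add up to [t (1 - q^n)], free of [k]. *)
Lemma conv_qrecS n :
  (1 - q ^+ n.+1) * conv a b n.+1 = t * (1 - q ^+ n) * conv a b n.
Proof.
have split_weight k : (0 <= k < n.+2)%N ->
    (1 - q ^+ n.+1) * (a k * b (n.+1 - k)%N) =
    (1 - q ^+ k) * a k * b (n.+1 - k)%N
    + q ^+ k * a k * ((1 - q ^+ (n.+1 - k)) * b (n.+1 - k)%N).
  case/andP=> _; rewrite ltnS => le_kn.
  have -> : q ^+ n.+1 = q ^+ k * q ^+ (n.+1 - k) by rewrite -exprD subnKC.
  by ring.
rewrite /conv big_distrr (eq_big_nat _ _ split_weight) big_split /=.
rewrite big_nat_recl // expr0 subrr !mul0r add0r.
rewrite [X in _ + X]big_nat_recr //= subnn expr0 subrr mul0r mulr0 addr0.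
rewrite -big_split big_distrr /=; apply: eq_big_nat => k /andP[_].
rewrite ltnS => le_kn.
have -> : q ^+ n = q ^+ k * q ^+ (n - k) by rewrite -exprD subnKC.
by rewrite subSS (subSn le_kn) aS bS; ring.
Qed.

Lemma conv_qrec : a 0 = 1 -> b 0 = 1 -> (forall n, q ^+ n.+1 != 1) ->
  conv a b = fun n => (n == 0)%:R.
Proof.
move=> a0 b0 q_neq1; apply/funext => n.
have conv0 : conv a b 0 = 1 by rewrite /conv big_nat1 a0 b0 mulr1.
case: n => [|n] //=.
have q_reg m : 1 - q ^+ m.+1 != 0 by rewrite subr_eq0 eq_sym.
elim: n => [|n IHn].
  apply: (mulfI (q_reg 0)).
  by rewrite conv_qrecS expr0 subrr mulr0 mul0r mulr0.
by apply: (mulfI (q_reg n.+1)); rewrite conv_qrecS IHn !mulr0.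
Qed.

End QRecurrence.

(** * The coefficients of the two operators *)

Section Coefficients.
Variables (R : realType) (q gamma : R).
Hypotheses (q_gt0 : 0 < q) (q_lt1 : q < 1).

Let subX_neq0 n : 1 - q ^+ n.+1 != 0.
Proof. by rewrite subr_eq0 eq_sym lt_eqF // exprn_ilt1 // ltW. Qed.

Let sub1q_neq0 : 1 - q != 0.
Proof. exact: (subX_neq0 0). Qed.

Let qX_neq0 n : q ^+ n != 0.
Proof. by rewrite expf_neq0 // gt_eqF. Qed.

Lemma qnum_nat n : qnum q n%:R = (1 - q ^+ n) / (1 - q).
Proof. by rewrite /qnum powR_mulrn // ltW. Qed.

Lemma qfactS k : qfact q k.+1 = qfact q k * ((1 - q ^+ k.+1) / (1 - q)).
Proof. by rewrite /qfact big_nat_recr //= qnum_nat. Qed.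

Lemma qfact_neq0 k : qfact q k != 0.
Proof.
elim: k => [|k IHk]; first by rewrite /qfact big_geq // oner_neq0.
by rewrite qfactS !mulf_neq0 // invr_neq0.
Qed.

(** The factor [q ^ k] gained by [q ^ 'C(k, 2)] clears the denominator of
    [1 - q ^ (gamma - k)], and the alternating sign turns the result into
    [q ^ gamma - q ^ k]. *)
Lemma nabla_coefS k :
  (1 - q ^+ k.+1) * nabla_coef q gamma k.+1 =
  (q `^ gamma - q ^+ k) * nabla_coef q gamma k.
Proof.
rewrite /nabla_coef big_nat_recr //= qfactS binS bin1 exprD (exprS (-1)).
rewrite {2}/qnum powRB ?(gt_eqF q_gt0) ?implybT // powR_mulrn ?ltW //.
have := subX_neq0 k; rewrite exprS => nz.
by field; rewrite nz sub1q_neq0 qX_neq0 qfact_neq0.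
Qed.

Lemma nabla_neg_coefS k :
  (1 - q ^+ k.+1) * nabla_neg_coef q gamma k.+1 =
  (1 - q `^ gamma * q ^+ k) * nabla_neg_coef q gamma k.
Proof.
rewrite /nabla_neg_coef big_nat_recr //= qfactS.
rewrite {2}/qnum powRD ?(gt_eqF q_gt0) ?implybT // powR_mulrn ?ltW //.
have := subX_neq0 k; rewrite exprS => nz.
by field; rewrite nz sub1q_neq0 qfact_neq0.
Qed.

Lemma conv_nabla_coefs :
  conv (nabla_coef q gamma) (nabla_neg_coef q gamma) = fun n => (n == 0)%:R.
Proof.
apply: (conv_qrec nabla_coefS nabla_neg_coefS).
- by rewrite /nabla_coef /qfact !big_geq // !expr0 divr1 !mulr1.
- by rewrite /nabla_neg_coef /qfact !big_geq // divr1.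
- by move=> n; rewrite eq_sym -subr_eq0.
Qed.

Lemma conv_nabla_coefsC :
  conv (fun k => (nabla_coef q gamma k)%:C%C)
       (fun k => (nabla_neg_coef q gamma k)%:C%C) = fun n => (n == 0)%:R.
Proof.
apply/funext => n; rewrite -(rmorph_nat (real_complex R)).
rewrite -(congr1 (fun c => c n) conv_nabla_coefs) /conv rmorph_sum.
by apply: eq_bigr => k _; rewrite [RHS]rmorphM.
Qed.

End Coefficients.

Unset Implicit Arguments.

Theorem lemma2p1 (R : realType) (q gamma : R)
    (q_gt0 : 0 < q) (q_lt1 : q < 1) (gamma_gt0 : 0 < gamma) :
  nabla q gamma \o nabla_neg q gamma = @id (omega R) /\
  nabla_neg q gamma \o nabla q gamma = @id (omega R).
Proof.
have nablaE : nabla q gamma = conv (fun k => (nabla_coef q gamma k)%:C%C).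
  by [].
have nabla_negE :
    nabla_neg q gamma = conv (fun k => (nabla_neg_coef q gamma k)%:C%C).
  by [].
have coefs_inv := conv_nabla_coefsC gamma q_gt0 q_lt1.
split; apply/funext => g; rewrite /= nablaE nabla_negE convA.
  by rewrite coefs_inv conv1s.
by rewrite (convC (fun k => (nabla_neg_coef q gamma k)%:C%C)) coefs_inv conv1s.
Qed.
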